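(* Let $k$ be a field and $e \geq 3$ an integer. Let $S = k[X_1, \dots, X_e]$ be the polynomial ring, set $X_{e+1} = X_1^2$, and for $1 \leq i, j \leq e$ let $\Delta_{ij} = X_iX_{j+1} - X_{i+1}X_j$. Put $\Delta = \Delta_{2,e}$, $N = (X_1, \dots, X_e)S$, and $$\mathfrak{a} = \left(\Delta_{ij} \mid 1 \leq i < j \leq e,\ (i,j) \neq (2,e)\right) + \Delta N.$$ Let $R = S/\mathfrak{a}$, let $M = N/\mathfrak{a}$, let $x_i$ be the image of $X_i$ in $R$ $(1\leq i\leq e)$, and let $J = (x_1) : M$ in $R$. Then $J^e = x_1J^{e-1}$ but $J^{e-1} \neq x_1J^{e-2}$.
   Context: The $\Delta_{ij}$ are the $2\times 2$ minors of the matrix $\begin{pmatrix} X_1 & X_2 & \cdots & X_{e-1} & X_e \\ X_2 & X_3 & \cdots & X_e & X_1^2\end{pmatrix}$. $S$ is regarded as a graded ring with $S_0 = k$ and $\deg X_i = e+i-1$; then $N = S_+$, and $\mathfrak{a}$ is a homogeneous ideal, so $R$ is graded with $M = R_+$. $(x_1):M = \{r\in R\mid rM\subseteq (x_1)\}$. *)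

(* Defs.v *)
From HB Require Import structures.
From mathcomp Require Import all_boot all_order all_algebra.
From mathcomp Require Import boolp classical_sets.
From mathcomp Require Import mpoly.

Set Implicit Arguments.
Unset Strict Implicit.
Unset Printing Implicit Defensive.

Import GRing.Theory.
Local Open Scope classical_set_scope.
Local Open Scope ring_scope.

Section Ideals.
Variable A : comNzRingType.
Implicit Types (I J G : set A) (x : A) (n : nat).

(* Not necessarily proper, unlike [idealr]. *)
Definition is_ideal I : Prop :=
  [/\ I 0, (forall x y, I x -> I y -> I (x + y)) &
      (forall a x, I x -> I (a * x))].

Definition ideal_gen G : set A := smallest is_ideal G.

Definition ideal_add I J : set A := [set x + y | x in I & y in J].

Definition ideal_mul I J : set A := ideal_gen [set x * y | x in I & y in J].

Fixpoint ideal_exp I n : set A :=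
  if n is m.+1 then ideal_mul I (ideal_exp I m) else setT.

(* The product x I is already an ideal when I is one. *)
Definition ideal_scale x I : set A := [set x * y | y in I].

Definition ideal_colon I J : set A := [set r | forall m, J m -> I (r * m)].

Lemma ideal_gen_ideal G : is_ideal (ideal_gen G).
Proof.
split.
- by move=> I [[]].
- by move=> x y Gx Gy I [II GI]; case: (II) => _ D _; apply: D; [apply: Gx|apply: Gy].
- by move=> a x Gx I [II GI]; case: (II) => _ _ M; apply: M; apply: Gx.
Qed.

Lemma ideal_scale_ideal x I : is_ideal I -> is_ideal (ideal_scale x I).
Proof.
case=> I0 ID IM; split.
- by exists 0; rewrite ?mulr0.
- by move=> _ _ [a Ia <-] [b Ib <-]; exists (a + b); [exact: ID|rewrite mulrDr].
- by move=> c _ [a Ia <-]; exists (c * a); [exact: IM|rewrite mulrCA].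
Qed.

Lemma ideal_add_ideal I J : is_ideal I -> is_ideal J -> is_ideal (ideal_add I J).
Proof.
case=> I0 ID IM [J0 JD JM]; split.
- by exists 0 => //; exists 0 => //; rewrite addr0.
- move=> _ _ [a Ia [b Jb <-]] [c Ic [d Jd <-]].
  by exists (a + c); [exact: ID|exists (b + d); [exact: JD|rewrite addrACA]].
- move=> c _ [a Ia [b Jb <-]].
  by exists (c * a); [exact: IM|exists (c * b); [exact: JM|rewrite mulrDr]].
Qed.

End Ideals.

Section Construction.
Variables (k : fieldType) (e : nat).

(* X_1, ..., X_e are the 0-based indeterminates 'X_0, ..., 'X_(e-1), and
   X_(e+1) = X_1^2; the values at all other indices are dummies. *)
Definition var (i : nat) : {mpoly k[e]} :=
  if i is j.+1 then
    if insub j is Some l then 'X_(l : 'I_e) else 0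
  else 0.

Definition X (i : nat) : {mpoly k[e]} :=
  if i == e.+1 then var 1 ^+ 2 else var i.

Definition Delta (i j : nat) : {mpoly k[e]} :=
  X i * X j.+1 - X i.+1 * X j.

Definition N : set {mpoly k[e]} :=
  ideal_gen [set X i | i in [set i | (1 <= i <= e)%N]].

Definition ideal_a : set {mpoly k[e]} :=
  ideal_add
    (ideal_gen [set f | exists i j : nat,
       [/\ (1 <= i < j)%N, (j <= e)%N, (i, j) <> (2, e)%N & f = Delta i j]])
    (ideal_scale (Delta 2 e) N).

Lemma X_at0 i : (X i).@[fun=> 0] = 0.
Proof.
have var0 j : (var j).@[fun=> 0] = 0.
  case: j => [|j] /=; first by rewrite meval0.
  by case: insub => [l|]; rewrite ?mevalXU ?meval0.
by rewrite /X; case: ifP => _; rewrite ?expr2 ?mevalM !var0 ?mul0r.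
Qed.

Definition ideal_a_pred (f : {mpoly k[e]}) : bool := `[< ideal_a f >].

Lemma ideal_a_idealr_closed : idealr_closed ideal_a_pred.
Proof.
have [F0 FD FM] : is_ideal ideal_a.
  by apply: ideal_add_ideal; [|apply: ideal_scale_ideal]; apply: ideal_gen_ideal.
split; first exact/asboolP.
- apply/negP => /asboolP [f Gf [_ [g _ <-]]] /(congr1 (meval (fun=> 0))).
  have D0 i j : (Delta i j).@[fun=> 0] = 0.
    by rewrite mevalB !mevalM !X_at0 !mul0r subrr.
  rewrite mevalD mevalM D0 mul0r addr0 meval1.
  have -> : f.@[fun=> 0] = 0.
    apply: (Gf [set h | h.@[fun=> 0] = 0]); split.
      split=> /= [|p q p0 q0|p q q0]; first by rewrite meval0.
        by rewrite mevalD p0 q0 addr0.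
      by rewrite mevalM q0 mulr0.
    by move=> _ [i [j [_ _ _ ->]]]; exact: D0.
  by move/eqP; rewrite eq_sym oner_eq0.
- move=> c f g /asboolP Ff /asboolP Fg.
  by apply/asboolP; apply: FD => //; apply: FM.
Qed.

HB.instance Definition _ :=
  isIdealr.Build {mpoly k[e]} ideal_a_pred ideal_a_idealr_closed.

Definition idealr_a : idealr {mpoly k[e]} := ideal_a_pred.

Definition R : comNzRingType := {ideal_quot idealr_a}.

Definition proj (f : {mpoly k[e]}) : R := (\pi_{ideal_quot idealr_a} f)%qT.

Definition M : set R := [set proj f | f in N].

Definition x (i : nat) : R := proj (X i).

Definition J : set R := ideal_colon (ideal_gen [set x 1]) M.

End Construction.

Arguments x k e i : clear implicits.
Arguments J k e : clear implicits.

(* Main.v *)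
Require Import Defs.
From mathcomp Require Import all_boot all_order all_algebra.
From mathcomp Require Import boolp classical_sets.
From mathcomp Require Import mpoly.
From mathcomp Require Import zify ring.

(** Write delta for the image of Delta in R; it is killed by M, and R / (delta)
    is the semigroup ring k[t^e, ..., t^(2e-1)], with x_i = t^(e+i-1).
    The grading shows that delta is not in (x_1), and x_i x_(e+3-i) is
    x_1^2 x_2 - delta for 3 <= i <= e; hence an element of J has no constant term
    and no x_i-term for i >= 3, while all x_i x_j lie in (x_1, delta).  So
    J = (x_1, x_2, delta), and J^n = x_1 J^(n-1) + (x_2^n) for n >= 2.
    Now x_2^e = x_1^(e+1) gives J^e = x_1 J^(e-1).  On the other hand, if
    x_2^(e-1) were in x_1 J^(e-2), then t^(e^2-e-1) would lie in
    (t^e, t^(e+1))^(e-2) in the semigroup ring, which it does not. *)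

Section Proof.
Set Implicit Arguments.
Unset Strict Implicit.
Import GRing.Theory.
Local Open Scope ring_scope.

(** * Generalities on ideals *)

Section Ideals.
Variable A : comNzRingType.
Implicit Types (I K G : set A) (a : A).

Lemma ideal_gen_sub G K : is_ideal K -> (G `<=` K)%classic ->
  (ideal_gen G `<=` K)%classic.
Proof. by move=> idK GK a; apply. Qed.

Lemma ideal_mul_sub I I' K : is_ideal K ->
  (forall a b, I a -> I' b -> K (a * b)) -> (ideal_mul I I' `<=` K)%classic.
Proof.
by move=> idK IIK; apply: ideal_gen_sub => // _ [a Ia [b Ib <-]]; exact: IIK.
Qed.

Lemma mem_ideal_gen G a : G a -> ideal_gen G a.
Proof. by move=> Ga I [_]; apply. Qed.

Lemma ideal_gen0 G : ideal_gen G 0.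
Proof. by case: (ideal_gen_ideal G). Qed.

Lemma mem_ideal_mul I I' a b : I a -> I' b -> ideal_mul I I' (a * b).
Proof. by move=> Ia Ib; apply: mem_ideal_gen; exists a => //; exists b. Qed.

Lemma ideal_exp_ideal I n : is_ideal (ideal_exp I n).
Proof. by case: n => [|n] //=; exact: ideal_gen_ideal. Qed.

Lemma mem_ideal_exp I a n : I a -> ideal_exp I n (a ^+ n).
Proof. by move=> Ia; elim: n => // n IHn; rewrite exprS; exact: mem_ideal_mul. Qed.

Lemma ideal_gen1P a b : ideal_gen [set a] b <-> exists c, b = c * a.
Proof.
split=> [|[c ->]]; last first.
  by have [_ _] := ideal_gen_ideal [set a]; apply; exact: mem_ideal_gen.
apply: (@ideal_gen_sub _ [set b | exists c, b = c * a]); last first.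
  by move=> _ ->; exists 1; rewrite mul1r.
split.
- by exists 0; rewrite mul0r.
- by move=> _ _ [c ->] [d ->]; exists (c + d); rewrite mulrDl.
- by move=> c _ [d ->]; exists (c * d); rewrite mulrA.
Qed.

Lemma ideal_colon_ideal I K : is_ideal I -> is_ideal (ideal_colon I K).
Proof.
case=> I0 ID IM; split=> [m Km|a b Ia Ib m Km|c a Ia m Km].
- by rewrite mul0r.
- by rewrite mulrDl; apply: ID; [exact: Ia|exact: Ib].
- by rewrite -mulrA; apply: IM; exact: Ia.
Qed.

End Ideals.

(** * The quotient ring [R] and the relations among its generators *)

Section Ring.
Variables (k : fieldType) (e : nat).
Hypothesis he : (3 <= e)%N.
Local Notation S := {mpoly k[e]}.
Local Notation X := (X k e).
Local Notation Delta := (Delta k e).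
Local Notation x := (x k e).
Local Notation J := (J k e).
Local Notation delta := (proj (Delta 2 e)).

Lemma X_ord i (ie : (i < e)%N) : X i.+1 = 'X_(Ordinal ie).
Proof. by rewrite /Defs.X eqSS ltn_eqF //= insubT. Qed.

Lemma X_last : X e.+1 = X 1 ^+ 2.
Proof. by rewrite /Defs.X eqxx eq_sym gtn_eqF // ltnS; lia. Qed.

(** Every monomial arises from a constant by multiplying by one variable at a time. *)
Lemma mpoly_X_ind (P : S -> Prop) :
  (forall c, P c%:MP) -> (forall f g, P f -> P g -> P (f + g)) ->
  (forall i f, (1 <= i <= e)%N -> P f -> P (X i * f)) -> forall f, P f.
Proof.
move=> PC PD PX; elim/mpolyind => [|c m p _ _ Pp]; first by rewrite -mpolyC0.
apply: PD => //; rewrite -mul_mpolyC mulrC mpolyXE_id.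
elim/big_rec: _ => [|[i ie] q _ Pq]; first by rewrite mul1r.
rewrite -mulrA; elim: (m _) => [|n IHn]; first by rewrite expr0 mul1r.
by rewrite exprS -mulrA -{1}X_ord; apply: PX => //; rewrite ie.
Qed.

Lemma projD (f g : S) : proj (f + g) = proj f + proj g.
Proof. exact: Quotient.pi_add. Qed.
Lemma projN (f : S) : proj (- f) = - proj f.
Proof. exact: Quotient.pi_opp. Qed.
Lemma projB (f g : S) : proj (f - g) = proj f - proj g.
Proof. by rewrite projD projN. Qed.
Lemma projM (f g : S) : proj (f * g) = proj f * proj g.
Proof. exact: Quotient.pi_mul. Qed.
Lemma proj_zero : proj (0 : S) = 0.
Proof. exact: (rmorph0 (\pi_{ideal_quot idealr_a k e}%qT)). Qed.
Lemma proj_one : proj (1 : S) = 1.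
Proof. exact: (rmorph1 (\pi_{ideal_quot idealr_a k e}%qT)). Qed.
Lemma projX (f : S) n : proj (f ^+ n) = proj f ^+ n.
Proof. by elim: n => [|n IHn]; rewrite ?proj_one // !exprS projM IHn. Qed.

Lemma proj_surj (r : R k e) : exists f, r = proj f.
Proof. by exists (repr r); rewrite /proj reprK. Qed.

Lemma proj_eqP (f g : S) : proj f = proj g <-> ideal_a (f - g).
Proof.
have E : (proj f == proj g) = ((f - g) \in idealr_a k e).
  by rewrite (Quotient.idealrBE (idealr_a k e)).
split=> [/eqP|af]; first by rewrite E => /asboolP.
by apply/eqP; rewrite E; apply/asboolP.
Qed.

Lemma proj_Delta i j : (1 <= i < j)%N -> (j <= e)%N -> (i, j) <> (2, e)%N ->
  proj (Delta i j) = 0.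
Proof.
move=> ij je ne; rewrite -proj_zero; apply/proj_eqP; rewrite subr0.
exists (Delta i j).
  by apply: mem_ideal_gen; exists i, j.
exists 0; last by rewrite addr0.
by exists 0; rewrite ?mulr0 //; exact: ideal_gen0.
Qed.

Lemma delta_x i : (1 <= i <= e)%N -> delta * x i = 0.
Proof.
move=> ie; rewrite -projM -proj_zero; apply/proj_eqP; rewrite subr0.
exists 0; first exact: ideal_gen0.
exists (Delta 2 e * X i); last by rewrite add0r.
by exists (X i) => //; apply: mem_ideal_gen; exists i.
Qed.

Lemma x_last : x e.+1 = x 1 ^+ 2.
Proof. by rewrite /Defs.x X_last projX. Qed.

Lemma proj_DeltaE i j : proj (Delta i j) = x i * x j.+1 - x i.+1 * x j.
Proof. by rewrite /Defs.Delta projB !projM. Qed.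

Lemma x2_mul i : (1 <= i <= e)%N -> x 2 * x i = x 1 * x i.+1.
Proof.
case/andP => i1 ie; have [->|i_ne] := eqVneq i 1%N; first by rewrite mulrC.
have := @proj_Delta 1 i; rewrite proj_DeltaE => E; apply/esym/eqP.
by rewrite -subr_eq0 E //; lia.
Qed.

(** Each further factor [x 2] is traded for [x 1] by [x2_mul], raising the other index by one; for n
    = e-1 that index is e+1. *)
Lemma x2_exp n : (n < e)%N -> x 2 ^+ n.+1 = x 1 ^+ n * x n.+2.
Proof.
elim: n => [|n IHn] ne; first by rewrite mul1r.
by rewrite exprS IHn ?(ltnW ne) // mulrCA x2_mul // exprSr mulrA.
Qed.

Lemma x2_exp_e : x 2 ^+ e = x 1 ^+ e.+1.
Proof.
case: e he x2_exp x_last => // n _ E L.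
by rewrite E // L -exprD addn2.
Qed.

(** * The ideal (x_1, x_2, delta) *)

Definition J_span : set (R k e) :=
  [set r | exists a b c, r = a * x 1 + b * x 2 + c * delta]%classic.

Lemma J_span_ideal : is_ideal J_span.
Proof.
split.
- by exists 0, 0, 0; rewrite !mul0r !addr0.
- move=> _ _ [a [b [c ->]]] [a' [b' [c' ->]]].
  by exists (a + a'), (b + b'), (c + c'); ring.
- by move=> d _ [a [b [c ->]]]; exists (d * a), (d * b), (d * c); ring.
Qed.

(* The minors move the two indices apart until one factor is X_1 or
   X_(e+1) = X_1^2; the minor Delta may be picked up on the way. *)
Lemma x_mul_span i j : (1 <= i <= j)%N -> (j <= e.+1)%N -> J_span (x i * x j).
Proof.
have J1 r : J_span (x 1 * r) by exists r, 0, 0; ring.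
elim: i j => // -[|i] IHi j ij; first by move=> _; exact: J1.
rewrite leq_eqVlt => /orP[/eqP ->|je].
  by rewrite x_last expr2 mulrCA; exact: J1.
have -> : x i.+2 * x j = x i.+1 * x j.+1 - proj (Delta i.+1 j).
  by rewrite proj_DeltaE; ring.
have [_ JD JM] := J_span_ideal.
apply: JD; first by apply: IHi => //; lia.
have [[-> ->]|ne] := EM ((i.+1, j) = (2, e)%N).
  by exists 0, 0, (-1); ring.
by rewrite proj_Delta ?oppr0; try lia; [case: J_span_ideal|].
Qed.

(** Here delta^2 = 0 as well: each term of delta = x_2 x_(e+1) - x_3 x_e has a factor that delta
    kills. *)
Lemma delta_J_span r : J_span r -> delta * r = 0.
Proof.
case=> a [b [c ->]].
have d1 : delta * x 1 = 0 by rewrite delta_x //; lia.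
have d2 : delta * x 2 = 0 by rewrite delta_x //; lia.
have d3 : delta * x 3 = 0 by rewrite delta_x //; lia.
have -> : delta * (a * x 1 + b * x 2 + c * delta) =
  a * (delta * x 1) + b * (delta * x 2) + c * (delta * delta) by ring.
rewrite d1 d2 {2}proj_DeltaE mulrBr !mulrA d2 d3; ring.
Qed.

(** * Two monomial evaluations into k[t] *)

Local Notation ev w :=
  (mmap (@polyC k) (fun i : 'I_e => (w (nat_of_ord i).+1 : {poly k}))).

Lemma ev_X (w : nat -> {poly k}) i : (1 <= i <= e)%N -> ev w (X i) = w i.
Proof. by case: i => // i ie; rewrite X_ord // mmapX mmap1U. Qed.

(* psi parametrises the semigroup ring; phi is its variant killing X_1 and X_2,
   used to show that delta is not in (x_1). *)
Definition phi_w (i : nat) : {poly k} := if (i <= 2)%N then 0 else 'X^(e + i - 1).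
Definition psi_w (i : nat) : {poly k} := 'X^(e + i - 1).
Local Notation phi := (ev phi_w).
Local Notation psi := (ev psi_w).

Lemma phi_X_last : phi (X e.+1) = 0.
Proof. by rewrite X_last rmorphXn /= ev_X ?expr2 ?mul0r //; lia. Qed.

Lemma psi_X i : (1 <= i <= e.+1)%N -> psi (X i) = psi_w i.
Proof.
case/andP => i1; rewrite leq_eqVlt => /orP[/eqP ->|ie]; last by rewrite ev_X ?i1.
rewrite X_last rmorphXn /= ev_X; last by lia.
by rewrite /psi_w -exprM; congr ('X^ _); lia.
Qed.

(** The least degree of a variable that survives under [phi] is e+2, attained by X_3. *)
Lemma phi_gap f d : (1 <= d <= e.+1)%N -> (phi f)`_d = 0.
Proof.
move=> hd; elim/mpoly_X_ind: f => [c|f g f0 g0|i f ie f0].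
- by rewrite mmapC coefC gtn_eqF //; lia.
- by rewrite rmorphD /= coefD f0 g0 addr0.
- rewrite rmorphM /= ev_X // /phi_w; case: ifP => i2; first by rewrite mul0r coef0.
  by rewrite coefXnM; case: ifP => //; lia.
Qed.

Lemma psi_gap f d : (1 <= d < e)%N -> (psi f)`_d = 0.
Proof.
move=> hd; elim/mpoly_X_ind: f => [c|f g f0 g0|i f ie f0].
- by rewrite mmapC coefC gtn_eqF //; lia.
- by rewrite rmorphD /= coefD f0 g0 addr0.
- by rewrite rmorphM /= ev_X // /psi_w coefXnM; case: ifP => //; lia.
Qed.

(** Both products have degree 2e+i+j-1; the pair (2,e) is included, so [psi] also kills Delta. *)
Lemma psi_Delta i j : (1 <= i < j)%N -> (j <= e)%N -> psi (Delta i j) = 0.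
Proof.
move=> ij je; rewrite /Defs.Delta rmorphB !rmorphM /= !psi_X; try lia.
rewrite /psi_w -!exprD; apply/eqP; rewrite subr_eq0; apply/eqP.
by congr ('X^ _); lia.
Qed.

Lemma psi_ideal_a f : ideal_a f -> psi f = 0.
Proof.
case=> g Gg [_ [h _ <-] <-]; rewrite rmorphD rmorphM /= psi_Delta; try lia.
rewrite mul0r addr0; move: g Gg.
apply: (@ideal_gen_sub _ _ [set g | psi g = 0]%classic).
  split=> /= [|a b a0 b0|a b b0]; first by rewrite rmorph0.
    by rewrite rmorphD /= a0 b0 addr0.
  by rewrite rmorphM /= b0 mulr0.
by move=> _ [i [j [ij je _ ->]]]; exact: psi_Delta.
Qed.

Lemma phi_N (h : S) : N h -> (phi h)`_0 = 0.
Proof.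
move: h; apply: (@ideal_gen_sub _ _ [set h | (phi h)`_0 = 0]%classic).
  split=> /= [|a b a0 b0|a b b0]; first by rewrite rmorph0 coef0.
    by rewrite rmorphD /= coefD a0 b0 addr0.
  by rewrite rmorphM /= coef0M b0 mulr0.
move=> _ [i ie <-] /=; rewrite ev_X // /phi_w; case: ifP => _.
  by rewrite coef0.
by rewrite coefXn; case: eqP => //; move: ie => /= ie; lia.
Qed.

Lemma phi_Delta2 : phi (Delta 2 e) = - 'X^(3 * e + 1).
Proof.
rewrite /Defs.Delta rmorphB !rmorphM /= phi_X_last mulr0 sub0r !ev_X; try lia.
rewrite /phi_w /= leqNgt he /= -exprD; congr (- 'X^ _); lia.
Qed.

(* 3e+1 is the degree of Delta.  For 3 <= j < e the generator Delta_(2,j) has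
   nonzero image of smaller degree, but its multiples do not reach degree 3e+1
   because of [phi_gap]. *)
Lemma phi_ideal_a f : ideal_a f -> (phi f)`_(3 * e + 1) = 0.
Proof.
case=> g Gg [_ [h Nh <-] <-]; rewrite rmorphD rmorphM /= phi_Delta2 coefD.
(* A multiple of Delta by an element of N contributes the constant term of [phi h], which is 0. *)
rewrite mulNr coefN coefXnM ltnn subnn phi_N // subr0.
(* The vanishing of one coefficient does not define an ideal; its vanishing for all multiples
   does. *)
suff: forall q, (phi (q * g))`_(3 * e + 1) = 0.
  by move=> /(_ 1); rewrite mul1r.
move: g Gg; apply: (@ideal_gen_sub _ _
  [set g | forall q, (phi (q * g))`_(3 * e + 1) = 0]%classic).
  split=> /= [q|a b a0 b0 q|a b b0 q]; first by rewrite mulr0 rmorph0 coef0.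
    by rewrite mulrDr rmorphD /= coefD a0 b0 addr0.
  by rewrite mulrA b0.
move=> _ [i [j [/andP[i1 ij] je ne ->]]] q.
have [i3|i2] := leqP 3 i.
  have [jlt|jge] := ltnP j e.
    suff -> : phi (q * Delta i j) = 0 by rewrite coef0.
    rewrite rmorphM /= /Defs.Delta rmorphB !rmorphM /= !ev_X /phi_w; try lia.
    rewrite !ifF -?exprD; try lia.
    apply/eqP; rewrite mulf_eq0 subr_eq0; apply/orP; right.
    by apply/eqP; congr ('X^ _); lia.
  (* Only the product X_(i+1) X_e survives, and its degree 3e+i-1 exceeds 3e+1. *)
  have {jge je}je : j = e by lia.
  subst j; rewrite rmorphM /= /Defs.Delta rmorphB !rmorphM /= phi_X_last mulr0 sub0r.
  rewrite !ev_X /phi_w; try lia.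
  rewrite !ifF -?exprD; try lia.
  by rewrite mulrN coefN coefMXn ifT ?oppr0 //; lia.
have E : phi (Delta i j) = - (phi_w i.+1 * phi_w j).
  rewrite /Defs.Delta rmorphB !rmorphM /= (ev_X phi_w (i := i)); last by lia.
  by rewrite {1}/phi_w ifT // mul0r sub0r !ev_X //; lia.
rewrite rmorphM /= E /phi_w; have [i1'|i1'] := leqP i.+1 2.
  by rewrite mul0r oppr0 mulr0 coef0.
have {i1 i1' i2} i2 : i = 2%N by lia.
subst i; have jlt : (j < e)%N.
  by rewrite ltn_neqAle je andbT; apply/eqP => je'; apply: ne; rewrite je'.
rewrite ifF -?exprD; last by lia.
rewrite mulrN coefN coefMXn ifF; last by lia.
by rewrite phi_gap ?oppr0 //; lia.
Qed.

(** * Normal forms modulo (x_1, x_2, delta), and the determination of [J] *)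

Local Notation scal c := (proj (c%:MP_[e])).

(** The constant term and the linear terms in X_3, ..., X_e of [f]. They can be read off [phi f] in
    degrees at most 2e-1, since a product of two of these variables has degree at least 2e+4. *)
Definition low_part (f : S) : R k e :=
  scal (phi f)`_0 + \sum_(i < e.+1 | (3 <= i)%N) scal (phi f)`_(e + i - 1) * x i.

Lemma low_partD f g : low_part (f + g) = low_part f + low_part g.
Proof.
rewrite /low_part rmorphD /= coefD mpolyCD projD addrACA -big_split /=.
by congr (_ + _); apply: eq_bigr => i _; rewrite coefD mpolyCD projD mulrDl.
Qed.

(** For i > j >= 3, the coefficient at x_i is that of [phi f] in degree i-j, which lies in the gap
    of [phi_gap]. *)
Lemma low_partX j f : (1 <= j <= e)%N ->
  low_part (X j * f) = if (j <= 2)%N then 0 else scal (phi f)`_0 * x j.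
Proof.
case/andP => j1 je; rewrite /low_part rmorphM /= ev_X ?j1 // /phi_w.
case: ifP => j2.
  rewrite mul0r coef0 proj_zero add0r big1 // => i _.
  by rewrite coef0 proj_zero mul0r.
rewrite coefXnM ifT; last by lia.
rewrite proj_zero add0r (bigD1 (Ordinal (je : (j < e.+1)%N))) /=; last by lia.
rewrite coefXnM ltnn subnn big1 ?addr0 // => i /andP[i3 ij].
have {}ij : (i : nat) <> j by move=> E; case/eqP: ij; apply: val_inj.
rewrite coefXnM; case: ifP => ij'; first by rewrite proj_zero mul0r.
by rewrite phi_gap ?proj_zero ?mul0r //; have := ltn_ord i; lia.
Qed.

Lemma low_part_span f : J_span (proj f - low_part f).
Proof.
have [J0 JD JM] := J_span_ideal.
elim/mpoly_X_ind: f => [c|f g Jf Jg|j f je Jf].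
- rewrite /low_part mmapC coefC eqxx big1 ?addr0 ?subrr // => i i3.
  by rewrite coefC gtn_eqF ?proj_zero ?mul0r //; lia.
- by rewrite low_partD projD opprD addrACA; exact: JD.
rewrite low_partX // projM; case: ifP => j2.
  have {je j2} [->|->] : j = 1%N \/ j = 2%N by lia.
    by exists (proj f), 0, 0; rewrite /Defs.x; ring.
  by exists 0, (proj f), 0; rewrite /Defs.x; ring.
(* The linear terms of [f] times [x j] give products of two generators, which [x_mul_span]
   absorbs. *)
have -> : x j * proj f - scal (phi f)`_0 * x j = x j * (proj f - low_part f)
    + \sum_(i < e.+1 | (3 <= i)%N) scal (phi f)`_(e + i - 1) * (x i * x j).
  rewrite /low_part; under [X in _ = _ + X]eq_bigr do rewrite mulrA.
  by rewrite -mulr_suml; ring.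
apply: (JD); first exact: JM.
elim/big_rec: _ => // i r i3 Jr; apply: JD => //; apply: JM.
have ilt := ltn_ord i.
by have [ij|ij] := leqP i j; [|rewrite mulrC]; apply: x_mul_span; lia.
Qed.

Lemma J_ideal : is_ideal J.
Proof. exact/ideal_colon_ideal/ideal_gen_ideal. Qed.

Lemma J_x1 : J (x 1).
Proof. by move=> m _; apply/ideal_gen1P; exists m; rewrite mulrC. Qed.

Lemma J_x2 : J (x 2).
Proof.
move=> _ [f Nf <-]; move: f Nf.
have [I0 ID IM] := ideal_gen_ideal [set x 1]%classic.
apply: (@ideal_gen_sub _ _ [set f | ideal_gen [set x 1] (x 2 * proj f)]%classic).
  split=> /= [|f g If Ig|f g Ig]; first by rewrite proj_zero mulr0.
    by rewrite projD mulrDr; exact: ID.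
  by rewrite projM mulrCA; exact: IM.
move=> _ [i ie <-]; apply/ideal_gen1P; exists (x i.+1).
by rewrite x2_mul // mulrC.
Qed.

(** Multiplication by x_(e+3-i) moves this coefficient to degree 3e+1; the product is a multiple of
    x_1, which [phi] kills, up to an element of the ideal, so [phi_ideal_a] applies. *)
Lemma J_phi f i : (3 <= i <= e)%N -> J (proj f) -> (phi f)`_(e + i - 1) = 0.
Proof.
move=> ie Jf; have j_e : (1 <= e + 3 - i <= e)%N by lia.
have /Jf : M (x (e + 3 - i)).
  by exists (X (e + 3 - i)) => //; apply: mem_ideal_gen; exists (e + 3 - i)%N.
case/ideal_gen1P => c; have [h ->] := proj_surj c.
rewrite -!projM => /proj_eqP/phi_ideal_a.
rewrite rmorphB !rmorphM /= !ev_X //; last by lia.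
rewrite /phi_w mulr0 subr0 ifF; last by lia.
rewrite coefMXn ifF; last by lia.
by congr (_`_ _ = 0); lia.
Qed.

Lemma J_sub_span r : J r -> J_span r.
Proof.
have [f -> Jf] := proj_surj r; have := low_part_span f.
rewrite /low_part big1 => [|i i3]; last first.
  by rewrite J_phi ?proj_zero ?mul0r //; have := ltn_ord i; lia.
suff -> : (phi f)`_0 = 0 by rewrite proj_zero addr0 subr0.
(* The constant term of [f] becomes the X_3-coefficient of [f * X 3], so [J_phi] applies to it. *)
have : J (proj (f * X 3)).
  by rewrite projM mulrC; have [_ _] := J_ideal; apply.
move/(@J_phi _ 3); rewrite rmorphM /= ev_X; last by lia.
by rewrite /phi_w coefMXn ltnn subnn; apply; lia.
Qed.

(** * Powers of [J]: generators and exponent gaps *)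

(** Any product of generators that involves x_1 goes into the first summand, and delta times an
    element of [J] is 0; only the pure power of x_2 remains. *)
Lemma ideal_exp_J_decomp n z : ideal_exp J n.+2 z -> exists w s,
  ideal_exp J n.+1 w /\ z = x 1 * w + s * x 2 ^+ n.+2.
Proof.
pose K n := [set z | exists w s,
  ideal_exp J n.+1 w /\ z = x 1 * w + s * x 2 ^+ n.+2]%classic.
have K_ideal m : is_ideal (K m).
  have [E0 ED EM] := ideal_exp_ideal J m.+1.
  split.
  - by exists 0, 0; split=> //; ring.
  - move=> _ _ [w [s [Ew ->]]] [w' [s' [Ew' ->]]].
    by exists (w + w'), (s + s'); split; [exact: ED|ring].
  - move=> c _ [w [s [Ew ->]]].
    by exists (c * w), (c * s); split; [exact: EM|ring].
(* The term in delta occurs only when the right factor comes from the first power of [J]; later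
   calls take [t] to be 0. *)
have step m y w s t : J y -> ideal_exp J m w ->
    K m (y * (x 1 * w + s * x 2 ^+ m.+1 + t * delta)).
  move=> Jy Ew; have Sy := J_sub_span Jy; have [a [b [c Ey]]] := Sy.
  have [E0 ED EM] := ideal_exp_ideal J m.+1.
  have dx2 : delta * x 2 = 0 by rewrite delta_x //; lia.
  exists (y * w + a * s * x 2 ^+ m.+1), (b * s); split.
    by apply: ED; [exact: mem_ideal_mul|apply: EM; apply: mem_ideal_exp; exact: J_x2].
  rewrite mulrDr (mulrCA y t) (mulrC y delta) delta_J_span // mulr0 addr0.
  rewrite mulrDr {2}Ey.
  have E : delta * x 2 ^+ m.+1 = 0 by rewrite exprS mulrA dx2 mul0r.
  rewrite mulrDl -[c * delta * _]mulrA [delta * (s * _)]mulrCA E !mulr0 addr0.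
  rewrite !exprS; ring.
move: z; apply: ideal_mul_sub; first exact: K_ideal.
elim: n => [|n IHn] y z Jy Ez.
  have [a [b [c ->]]] : J_span z.
    move: z Ez; apply: ideal_mul_sub; first exact: J_span_ideal.
    move=> u v Ju _; rewrite mulrC; have [_ _] := J_span_ideal; apply.
    exact: J_sub_span.
  by rewrite (mulrC a) -{1}[x 2]expr1; exact: step.
have [w [s [Ew ->]]] := ideal_mul_sub (K_ideal n) IHn Ez.
by rewrite -[_ + _]addr0 -[0](mul0r delta); exact: step.
Qed.

(* Gaps in the exponents of (t^e, t^(e+1))^n; for n = e-2 the second one is
   reduced to e^2-e-1. *)
Definition gaps n (p : {poly k}) : Prop :=
  forall d, (d < e * n)%N \/ (e * n + n < d < e * n + e)%N -> p`_d = 0.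

(** The choice of lift is immaterial, because [psi] kills the ideal by [psi_ideal_a]. *)
Definition gap_ideal n : set (R k e) :=
  [set r | exists2 f, r = proj f & gaps n (psi f)]%classic.

Lemma gap_ideal_ideal n : is_ideal (gap_ideal n).
Proof.
split.
- by exists 0; rewrite ?proj_zero // rmorph0 => d _; rewrite coef0.
- move=> _ _ [f -> Gf] [g -> Gg]; exists (f + g); first by rewrite projD.
  by move=> d hd; rewrite rmorphD /= coefD Gf ?Gg ?addr0.
- move=> a _ [f -> Gf]; have [h ->] := proj_surj a.
  exists (h * f); first by rewrite projM.
  (* The exponents of [psi h] are 0 or at least e; lowering a degree below e*n+e by at least e lands
     below e*n, in the first gap. *)
  move=> d hd; rewrite rmorphM /= coefM big1 // => -[i /= id] _.
  have [->|i0] := eqVneq i 0%N; first by rewrite subn0 Gf ?mulr0.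
  have [ie|ie] := ltnP i e; first by rewrite psi_gap ?mul0r //; lia.
  by rewrite Gf ?mulr0 //; lia.
Qed.

(** Multiplying by x_1 or x_2 shifts exponents by e or e+1, which carries the gaps for n to those
    for n+1; delta maps to 0. *)
Lemma ideal_exp_J_gap n z : ideal_exp J n z -> gap_ideal n z.
Proof.
elim: n z => [|n IHn] z /=.
  have [f ->] := proj_surj z; exists f => // d hd; apply: psi_gap; lia.
move: z; apply: ideal_mul_sub; first exact: gap_ideal_ideal.
have [I0 ID IM] := gap_ideal_ideal n.+1.
move=> y z /J_sub_span [a [b [c ->]]] /IHn [f -> Gf].
have G1 : gap_ideal n.+1 (x 1 * proj f).
  exists (X 1 * f); first by rewrite projM.
  move=> d hd; rewrite rmorphM /= psi_X ?coefXnM; last by lia.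
  by case: ifP => // de; apply: Gf; lia.
have G2 : gap_ideal n.+1 (x 2 * proj f).
  exists (X 2 * f); first by rewrite projM.
  move=> d hd; rewrite rmorphM /= psi_X ?coefXnM; last by lia.
  by case: ifP => // de; apply: Gf; lia.
have Gd : gap_ideal n.+1 (delta * proj f).
  exists (Delta 2 e * f); first by rewrite projM.
  by move=> d _; rewrite rmorphM /= psi_Delta ?mul0r ?coef0 //; lia.
rewrite !mulrDl -!mulrA.
by apply: (ID); [apply: (ID)|]; apply: (IM).
Qed.

(** * The equality for J^e and the inequality for J^(e-1) *)

Lemma ideal_exp_J_e :
  ideal_exp J e = ideal_scale (x 1) (ideal_exp J (e - 1)).
Proof.
suff J_exp n : n.+2 = e -> ideal_exp J n.+2 = ideal_scale (x 1) (ideal_exp J n.+1).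
  have := J_exp (e - 2)%N.
  have -> : (e - 2).+2 = e by lia.
  have -> : (e - 2).+1 = (e - 1)%N by lia.
  exact.
move=> ne; have [_ ED EM] := ideal_exp_ideal J n.+1.
apply/seteqP; split=> [z|_ [w Ew <-]]; last first.
  by apply: mem_ideal_mul => //; exact: J_x1.
case/ideal_exp_J_decomp => w [s [Ew ->]].
(* As n+2 = e, the remaining power x_2^e equals x_1 times x_1^(n+2). *)
exists (w + s * x 1 ^+ n.+2); last by rewrite ne x2_exp_e exprS; ring.
apply: ED => //; apply: (EM); rewrite exprS; apply: EM.
by apply: mem_ideal_exp; exact: J_x1.
Qed.

Lemma ideal_exp_J_e1 :
  ideal_exp J (e - 1) <> ideal_scale (x 1) (ideal_exp J (e - 2)).
Proof.
move=> E; have : ideal_exp J (e - 1) (x 2 ^+ (e - 1)).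
  by apply: mem_ideal_exp; exact: J_x2.
rewrite E => -[w /ideal_exp_J_gap [f -> Gf]].
rewrite -projM -projX => /proj_eqP/psi_ideal_a.
(* The degree of x_2^(e-1) is (e+1)(e-1). Removing x_1 leaves e^2-e-1, the only integer strictly
   between e(e-2)+(e-2) and e(e-2)+e. *)
move/(congr1 (fun p : {poly k} => p`_(e ^ 2 - 1))).
rewrite rmorphB rmorphM rmorphXn /= !psi_X; try lia.
rewrite coef0 coefB coefXnM ifF ?Gf; try nia.
rewrite -exprM coefXn; case: eqP => [_|]; try nia.
by move/eqP; rewrite sub0r oppr_eq0 oner_eq0.
Qed.

End Ring.
End Proof.

Theorem mainTheorem11 (k : fieldType) (e : nat) (he : (3 <= e)%N) :
  ideal_exp (J k e) e = ideal_scale (x k e 1) (ideal_exp (J k e) (e - 1)) /\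
  ideal_exp (J k e) (e - 1) <> ideal_scale (x k e 1) (ideal_exp (J k e) (e - 2)).
Proof. by split; [exact: ideal_exp_J_e|exact: ideal_exp_J_e1]. Qed.
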